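(* Let $G$ be a finite group and let $K=N_G(H)$ be a local subgroup of $G$ for some nontrivial solvable subgroup $H$ of $G$. Then for every $x\in H$, we have $K\subseteq Sol_G(x)$.
   Context: For a finite group $G$ and $x\in G$, the solvabilizer of $x$ is $Sol_G(x)=\{y\in G : \langle x,y\rangle \text{ is solvable}\}$ (not necessarily a subgroup). A local subgroup of $G$ is a subgroup $K$ of $G$ such that $K=N_G(H)$ for some nontrivial solvable subgroup $H$ of $G$, where $N_G(H)$ is the normalizer of $H$ in $G$. *)

(* Defs.v *)
From mathcomp Require Import all_boot all_fingroup all_solvable.

Set Implicit Arguments.
Unset Strict Implicit.
Unset Printing Implicit Defensive.

Import GroupScope.

(* In general only a set, not a subgroup: hence {set gT} and no group
   structure. *)
Definition Sol (gT : finGroupType) (G : {set gT}) (x : gT) : {set gT} :=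
  [set y in G | solvable <<[set x; y]>>].

(* Main.v *)
Require Import Defs.
From mathcomp Require Import all_boot all_fingroup all_solvable.

Set Implicit Arguments.
Unset Strict Implicit.
Unset Printing Implicit Defensive.

Import GroupScope.

(** If [y] normalizes [H], then [H <*> <[y]>] is an extension of the solvable group [H] by a cyclic
    group, hence solvable ([solvable_joing_cycle]). For [x] in [H] it contains the subgroup
    generated by [x] and [y], which inherits solvability. *)

Lemma solvable_joing_cycle (gT : finGroupType) (H : {group gT}) (y : gT) :
  solvable H -> y \in 'N(H) -> solvable (H <*> <[y]>).
Proof.
move=> solH nHy; have nHY : <[y]> \subset 'N(H) by rewrite cycle_subG.
have nsH : H <| H <*> <[y]> by rewrite normalYl.
(* Modulo [H] the join collapses to the image of [<[y]>], which is abelian. *)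
rewrite (series_sol nsH) solH quotientYidl //.
by rewrite quotient_sol // abelian_sol // cycle_abelian.
Qed.

Theorem lemma4p1 (gT : finGroupType) (G H K : {group gT})
  (sHG : H \subset G) (ntH : H :!=: 1) (solH : solvable H)
  (defK : K :=: 'N_G(H)) :
  forall x : gT, x \in H -> K \subset Sol G x.
Proof.
move=> x Hx; apply/subsetP => y; rewrite defK => /setIP[Gy nHy]; rewrite inE Gy.
apply: solvableS (solvable_joing_cycle solH nHy).
rewrite gen_subG subUset !sub1set.
by rewrite (subsetP (joing_subl _ _)) // (subsetP (joing_subr _ _)) // cycle_id.
Qed.
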